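(* Let $\psi(z)=1+\sum_{k\ge 1}\psi_k z^k$ be a formal power series with real coefficients and let $l\ge 0$ be an integer. The B-series associated with the moment of order $l+1$ of the inverse tree factorial, i.e. with $B(t)=1/(t!)^{l+1}$, $$Y(z)=\sum_{t\in\mathcal{R}}\frac{z^{|t|}}{|t|!}\,\alpha(t)\,\frac{1}{(t!)^{l+1}}\,t!\,\delta_t,$$ satisfies the differential equation $$(\theta+1)^l\,\frac{d}{dz}Y=\psi(Y)$$ as an identity of formal power series in $z$.
   Context: $\mathcal{R}$ is the set of (isomorphism classes of) finite non-empty rooted trees, non-planar and unlabelled; $|t|$ is the number of nodes of $t$. $B_+(t_1,\dots,t_k)$ denotes the rooted tree obtained by creating a new root and joining it to the roots of $t_1,\dots,t_k$; every $t\in\mathcal{R}$ is of this form, with $k$ the number of children of the root ($k=0$ for the one-node tree). Tree factorial: $t!=|t|\prod_{i=1}^k t_i!$ for $t=B_+(t_1,\dots,t_k)$. $\alpha(t)$: the number of rooted labelled trees of shape $t$, i.e. the number, up to isomorphism of labelled rooted trees, of bijective labellings $l:V\to\{1,\dots,|t|\}$ of the nodes of $t$ with $l(u)<l(v)$ whenever $u\neq v$ and $u$ lies on the path from the root to $v$. Elementary differentials: $\delta_{t}=1$ for the one-node tree and $\delta_t=\psi^{(k)}(0)\prod_{i=1}^k\delta_{t_i}$ for $t=B_+(t_1,\dots,t_k)$, where $\psi^{(k)}(0)=k!\,\psi_k$. $\theta=z\,\frac{d}{dz}$ is Euler's operator, so $(\theta+1)^l z^n=(n+1)^l z^n$. 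*)

(* Defs.v *)
From HB Require Import structures.
From mathcomp Require Import all_boot all_order all_algebra.
From mathcomp Require Import generic_quotient.
From mathcomp Require Import all_classical all_reals.

Set Implicit Arguments.
Unset Strict Implicit.
Unset Printing Implicit Defensive.

Import Order.TTheory GRing.Theory Num.Theory.

Local Open Scope ring_scope.

(* Planar rooted trees, used only as concrete models of rooted trees: the     *)
(* latter are their classes modulo isomorphism, see rtree below.              *)

Inductive ptree := PNode of seq ptree.

Fixpoint ptree_encode (t : ptree) : GenTree.tree unit :=
  let: PNode s := t in GenTree.Node 0 (map ptree_encode s).

Fixpoint ptree_decode (t : GenTree.tree unit) : ptree :=
  match t with
  | GenTree.Leaf _ => PNode [::]
  | GenTree.Node _ s => PNode (map ptree_decode s)
  end.

Lemma ptree_encodeK : cancel ptree_encode ptree_decode.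
Proof.
rewrite /cancel; fix IH 1 => -[s] /=; congr PNode.
by elim: s => //= t s ->; rewrite IH.
Qed.

HB.instance Definition _ := Countable.copy ptree (can_type ptree_encodeK).

(* A node is given by its address: [::] is the root, and i :: u is the node   *)
(* of address u in the i-th branch.                                           *)
Fixpoint nodes (t : ptree) : seq (seq nat) :=
  let: PNode s := t in
  [::] :: [seq i :: u | i <- iota 0 (size s), u <- nth [::] (map nodes s) i].

Definition node (t : ptree) : finType := seq_sub (nodes t).

Definition is_parent (t : ptree) (u v : node t) : bool :=
  prefix (val u) (val v) && (size (val v) == (size (val u)).+1).

Definition on_root_path (t : ptree) (u v : node t) : bool :=
  prefix (val u) (val v).

(* A bijection of the nodes preserving the edges oriented away from the root, *)
(* hence also the root, which is the only node without a parent.              *)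
Definition is_iso (t1 t2 : ptree) (f : {ffun node t1 -> node t2}) : bool :=
  [&& injectiveb f, [forall v, exists u, f u == v]
    & [forall u, forall v, is_parent (f u) (f v) == is_parent u v]].

Definition isomorphic : rel ptree :=
  fun t1 t2 => [exists f : {ffun node t1 -> node t2}, is_iso f].

Lemma isomorphicP t1 t2 :
  reflect (exists2 f : node t1 -> node t2, bijective f &
             forall u v, is_parent (f u) (f v) = is_parent u v)
          (isomorphic t1 t2).
Proof.
apply: (iffP existsP) => [[f /and3P[/injectiveP f_inj /forallP f_surj f_par]]|].
  exists f; last by move=> u v; apply/eqP; move/forallP/(_ u)/forallP: f_par.
  pose g v := xchoose (existsP (f_surj v)).
  have fgK : cancel g f by move=> v; apply/eqP/(xchooseP (existsP (f_surj v))).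
  by exists g => // u; apply: f_inj; rewrite fgK.
move=> [f [g fK gK] f_par]; exists (finfun f); apply/and3P; split.
- by apply/injectiveP => u v; rewrite !ffunE; apply: can_inj.
- by apply/forallP => v; apply/existsP; exists (g v); rewrite ffunE gK.
- by apply/forallP => u; apply/forallP => v; rewrite !ffunE f_par.
Qed.

Lemma isomorphic_refl : reflexive isomorphic.
Proof. by move=> t; apply/isomorphicP; exists id => //; exists id. Qed.

Lemma isomorphic_sym : symmetric isomorphic.
Proof.
suff sub t1 t2 : isomorphic t1 t2 -> isomorphic t2 t1.
  by move=> t1 t2; apply/idP/idP; apply: sub.
move=> /isomorphicP[f [g fK gK] f_par]; apply/isomorphicP.
by exists g => [|u v]; [exists f | rewrite -f_par !gK].
Qed.

Lemma isomorphic_trans : transitive isomorphic.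
Proof.
move=> t2 t1 t3 /isomorphicP[f f_bij f_par] /isomorphicP[g g_bij g_par].
apply/isomorphicP; exists (g \o f); first exact: bij_comp.
by move=> u v /=; rewrite g_par f_par.
Qed.

Definition iso_equiv : equiv_rel ptree :=
  EquivRel isomorphic isomorphic_refl isomorphic_sym isomorphic_trans.

Definition rtree : Type := {eq_quot iso_equiv}%qT.

HB.instance Definition _ := Choice.on rtree.
HB.instance Definition _ := EqQuotient.on rtree.

(* The quantities below on planar trees are invariant under isomorphism, so   *)
(* those of a class are computed on its representative repr t.                *)

Definition porder (t : ptree) : nat := #|{: node t}|.

Fixpoint pfactorial (t : ptree) : nat :=
  let: PNode s := t in (porder t * \prod_(x <- map pfactorial s) x)%N.

(* The labels are 0, ..., |t| - 1 instead of 1, ..., |t|. *)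
Definition labellings (t : ptree) : {set {ffun node t -> 'I_(porder t)}} :=
  [set l : {ffun node t -> 'I_(porder t)} | injectiveb l &&
    [forall u, forall v, (u != v) && on_root_path u v ==> (l u < l v)%N]].

(* Two labellings give isomorphic labelled trees when they differ by an       *)
(* automorphism of t.                                                         *)
Definition labelled_iso (t : ptree) : rel {ffun node t -> 'I_(porder t)} :=
  fun l1 l2 => [exists f : {ffun node t -> node t},
    is_iso f && [forall u, l2 (f u) == l1 u]].

Definition palpha (t : ptree) : nat :=
  #|equivalence_partition (@labelled_iso t) (labellings t)|.

Definition tree_order (t : rtree) : nat := porder (repr t).
Definition tree_factorial (t : rtree) : nat := pfactorial (repr t).
Definition alpha (t : rtree) : nat := palpha (repr t).

(* A formal power series is the sequence of its coefficients. *)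

Definition fps (R : pzRingType) : Type := nat -> R.

Section FormalPowerSeries.
Variable R : pzRingType.
Implicit Types a b p : fps R.

Definition fps_one : fps R := fun n => (n == 0%N)%:R.

Definition fps_z : fps R := fun n => (n == 1%N)%:R.

Definition fps_add a b : fps R := fun n => a n + b n.

Definition fps_mul a b : fps R := fun n => \sum_(i < n.+1) a i * b (n - i)%N.

Definition fps_exp a (k : nat) : fps R := iter k (fps_mul a) fps_one.

(* p(a), meaningful when a 0 = 0: then a^k has no term of degree < k, and the *)
(* sum over all k of p_k a^k reduces in degree n to the terms with k <= n.    *)
Definition fps_comp p a : fps R :=
  fun n => \sum_(k < n.+1) p k * fps_exp a k n.

Definition fps_deriv a : fps R := fun n => n.+1%:R * a n.+1.

(* theta = z d/dz *)
Definition fps_euler a : fps R := fps_mul fps_z (fps_deriv a).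

(* theta + 1 *)
Definition fps_euler1 a : fps R := fps_add (fps_euler a) a.

End FormalPowerSeries.

Section BSeries.
Variables (R : realType) (psi : fps R).

(* The k-th derivative of psi at 0. *)
Definition deriv_at0 (k : nat) : R := k`!%:R * psi k.

Fixpoint pdelta (t : ptree) : R :=
  let: PNode s := t in
  if s is [::] then 1
  else deriv_at0 (size s) * \prod_(x <- map pdelta s) x.

Definition delta (t : rtree) : R := pdelta (repr t).

(* There are finitely many rooted trees of a given order, so each coefficient *)
(* is a genuine finite sum.                                                   *)
Definition Bseries (B : rtree -> R) : fps R := fun n =>
  \sum_(t \in [set t : rtree | tree_order t = n]%classic)
    ((tree_order t)`!%:R)^-1 * (alpha t)%:R * B t * (tree_factorial t)%:R
      * delta t.

End BSeries.

(* Main.v *)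
Require Import Defs.
From mathcomp Require Import all_boot all_order all_algebra.
From mathcomp Require Import all_classical all_reals.
From mathcomp Require Import perm zify ring.

Set Implicit Arguments.
Unset Strict Implicit.
Unset Printing Implicit Defensive.

Import Order.TTheory GRing.Theory Num.Theory.

Local Open Scope ring_scope.

(* Let k(t) be the product over the nodes v of t of (number of children of    *)
(* v)!, and e(t) the number of planar trees of shape t.  The hook length      *)
(* formula counts n! / t! increasing labellings of t, and Aut(t) acts freely  *)
(* on them, so alpha(t) |Aut t| t! = n!.  Ordering the children of every node *)
(* of t in all possible ways gives e(t) |Aut t| = k(t).  Hence the term of t  *)
(* in Y is e(t) times a weight depending on the shape only, and Y is the sum  *)
(* of w(p) = delta_p / (k(p) (p!)^(l+1)) over all planar trees p.  As         *)
(* w(B_+(p_1, ..., p_k)) = psi_k w(p_1) ... w(p_k) / (n+1)^(l+1) for a tree   *)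
(* of order n+1, removing the root gives                                      *)
(* (n+1)^(l+1) Y_(n+1) = sum_k psi_k [z^n] Y^k.                               *)

(** * The hook length formula *)

(** Non-planar trees have automorphisms, so their generating series does not factor at the root;
    planar trees have none, and a planar tree is exactly an ordered list of branches. The proof
    therefore rewrites Y as a sum over planar trees, where removing the root is a bijection. Two
    counts make this possible. [card_labellings] (hook lengths) and [palpha_niso] (free action of
    the automorphisms) combine into [palpha_formula]; [niso_PNode] (an isomorphism permutes the
    branches) leads to [count_isomorphic]. Dividing one by the other eliminates the automorphisms in
    [Bseries_term], and [Bseries_ptrees] sums over the classes. The recursion at the root is
    [weight_PNode] with [sum_forests_weight], and [iter_fps_euler1E] supplies the powers of n+1. *)

Section HookLength.
Local Open Scope nat_scope.
Variables (T : finType) (le : rel T).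
Hypotheses (le_refl : reflexive le) (le_trans : transitive le).
Hypothesis le_chain : forall x y z, le x z -> le y z -> le x y || le y x.

Definition hook (v : T) : {set T} := [set u | le v u].

(** Monotonicity is imposed only below nodes of [D], so that growing [D] interpolates between all
    bijections ([D] empty) and increasing labellings ([D] full). *)
Definition increasing_on (D : {set T}) : {set {ffun T -> 'I_#|T|}} :=
  [set l : {ffun T -> 'I_#|T|} | injectiveb l &&
    [forall u in D, forall x, (u != x) && le u x ==> (l u < l x)]].

Definition upset (D : {set T}) := forall u x, u \in D -> le u x -> x \in D.

Lemma increasing_onP (D : {set T}) (l : {ffun T -> 'I_#|T|}) :
  reflect (injective l /\ forall u x, u \in D -> u != x -> le u x -> l u < l x)
          (l \in increasing_on D).
Proof.
rewrite inE; apply: (iffP andP) => -[/injectiveP li H]; split=> //.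
  by move=> u x uD ux lux; have /forall_inP/(_ u uD)/forallP/(_ x) := H;
    rewrite ux lux.
  apply/forall_inP => u uD; apply/forallP => x; apply/implyP => /andP[ux lux].
  exact: H.
Qed.

Implicit Type l : {ffun T -> 'I_#|T|}.

(* To add to D the node v, all of whose proper descendants are already in D,  *)
(* classify the labellings increasing on D :\ v by the rank of the label of v *)
(* in the hook of v.  Exchanging the labels of v and of the node of adjacent  *)
(* rank shows that all classes have the same cardinality, and the class of    *)
(* rank 0 is increasing_on D.                                                 *)
Section Step.
Variables (D : {set T}) (v : T).
Hypotheses (vD : v \in D) (upD' : upset (D :\ v)).

Definition hook_rank (l : {ffun T -> 'I_#|T|}) (u : T) : nat :=
  #|[set x in hook v | l x < l u]|.

Lemma hook_rank_lt l x y : x \in hook v ->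
  (hook_rank l x < hook_rank l y) = (l x < l y).
Proof.
move=> xv; apply/idP/idP => [|lxy].
  apply: contraTT; rewrite -!leqNgt => lyx; apply: subset_leq_card.
  by apply/fintype.subsetP => z; rewrite !inE => /andP[-> /leq_trans]; apply.
apply: proper_card; apply/properP; split.
  apply/fintype.subsetP => z; rewrite !inE => /andP[-> /ltn_trans].
  exact.
by exists x; rewrite !inE ?lxy ?ltnn ?andbF // andbT; rewrite inE in xv.
Qed.

Lemma hook_rank_inj l x y : injective l -> x \in hook v -> y \in hook v ->
  hook_rank l x = hook_rank l y -> x = y.
Proof.
move=> li xv yv e; apply/li/val_inj.
by case: (ltngtP (l x) (l y)) => //; rewrite -hook_rank_lt // e ltnn.
Qed.

Lemma ltn_hook_rank l x : x \in hook v -> hook_rank l x < #|hook v|.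
Proof.
move=> xv; apply: proper_card; apply/properP; split.
  by apply/fintype.subsetP => z; rewrite inE => /andP[].
by exists x => //; rewrite inE ltnn andbF.
Qed.

Lemma hook_rank_surj l r : injective l -> r < #|hook v| ->
  exists2 w, w \in hook v & hook_rank l w = r.
Proof.
move=> li rh.
pose f x : 'I_#|hook v| := insubd (Ordinal rh) (hook_rank l x).
have fE x : x \in hook v -> f x = hook_rank l x :> nat.
  by move=> xv; rewrite val_insubd ltn_hook_rank.
have fi : {in hook v &, injective f}.
  by move=> x y xv yv /(congr1 val); rewrite /= !fE //; apply: hook_rank_inj.
have /imsetP[w wv e] : Ordinal rh \in f @: hook v.
  suff -> : f @: hook v = [set: 'I_#|hook v|]%SET by rewrite inE.
  by apply/eqP; rewrite eqEcard finset.subsetT cardsT card_ord (card_in_imset fi) leqnn.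
by exists w => //; rewrite -fE // -e.
Qed.

Definition rank_class r := [set l in increasing_on (D :\ v) | hook_rank l v == r].

Definition rank_swap r (l : {ffun T -> 'I_#|T|}) : {ffun T -> 'I_#|T|} :=
  let w := odflt v [pick w in hook v | hook_rank l w == r] in
  [ffun u => l (tperm v w u)].

Lemma rank_swapE r l w : injective l -> w \in hook v -> hook_rank l w = r ->
  rank_swap r l = [ffun u => l (tperm v w u)].
Proof.
move=> li wv rw; rewrite /rank_swap; case: pickP => [w' /andP[w'v /eqP rw']|/(_ w)].
  by rewrite (hook_rank_inj li w'v wv) // rw rw'.
by rewrite wv rw eqxx.
Qed.

(** Both [v] and [w] lie in the hook of [v], so the exchange maps this hook to itself. *)
Lemma hook_rank_tperm (l : {ffun T -> 'I_#|T|}) w u : w \in hook v ->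
  hook_rank [ffun u => l (tperm v w u)] u = hook_rank l (tperm v w u).
Proof.
move=> wv; rewrite /hook_rank -(card_imset _ (@perm_inj _ (tperm v w))).
apply: eq_card => x; apply/imsetP/idP => [[y + ->]|].
  rewrite !inE !ffunE => /andP[vy ->]; rewrite andbT.
  by case: tpermP => // _; rewrite ?le_refl //; rewrite inE in wv.
rewrite !inE => /andP[vx lx]; exists (tperm v w x); last by rewrite tpermK.
rewrite !inE !ffunE tpermK lx andbT.
by case: tpermP => // _; rewrite ?le_refl //; rewrite inE in wv.
Qed.

(** The ranks [r] and [r'] differ by at most one, so exchanging the labels of [v] and [w] keeps
    their order relative to every other node of the hook. A constraint from [D :\ v] can only be
    affected if it involves [w], and then its other node also lies in the hook: this is clear for a
    node below [w]; a node of [D :\ v] above [w] is comparable with [v] by [le_chain], and cannot be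
    above [v] because [D :\ v] is an upset. *)
Lemma rank_swap_class r r' l : r <= r'.+1 -> r' <= r.+1 -> r' < #|hook v| ->
  l \in rank_class r ->
  rank_swap r' l \in rank_class r' /\ rank_swap r (rank_swap r' l) = l.
Proof.
move=> rr' r'r r'h; rewrite inE => /andP[/increasing_onP[li ldec] /eqP rv].
have [w wv rw] := hook_rank_surj li r'h.
have vv : v \in hook v by rewrite inE.
rewrite (rank_swapE li wv rw).
have l'i : injective [ffun u => l (tperm v w u)].
  by move=> x y; rewrite !ffunE => /li/perm_inj.
split; last first.
  rewrite (@rank_swapE _ _ w) // ?hook_rank_tperm ?tpermR //.
  by apply/ffunP => u; rewrite !ffunE tpermK.
rewrite inE hook_rank_tperm // tpermL rw eqxx andbT.
apply/increasing_onP; split => // x y xD' xy lxy.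
have yD' := upD' xD' lxy; have lxlt := ldec _ _ xD' xy lxy.
have [xv yv] : x != v /\ y != v by move: xD' yD'; rewrite !inE => /andP[? _] /andP[].
rewrite !ffunE; case: (tpermP v w x) xy => [/eqP|xw _|/eqP _ /eqP xw xy].
- by rewrite (negPf xv).
- case: (tpermP v w y) => [/eqP|yw|//]; first by rewrite (negPf yv).
    by rewrite xw yw ltnn in lxlt.
  move=> _ _; rewrite xw in lxlt lxy; rewrite inE in wv.
  have yh : y \in hook v by rewrite inE (le_trans wv).
  rewrite -hook_rank_lt // rv; move: lxlt; rewrite -hook_rank_lt ?inE // rw => lt.
  rewrite ltn_neqAle (leq_trans rr' lt) andbT -rv.
  by apply/eqP => /(hook_rank_inj li vv yh) e; rewrite e eqxx in yv.
- case: (tpermP v w y) => [/eqP|yw|//]; first by rewrite (negPf yv).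
  rewrite yw in lxlt lxy.
  have xh : x \in hook v.
    rewrite inE; rewrite inE in wv; case/orP: (le_chain lxy wv) => // lxv.
    by have := upD' xD' lxv; rewrite !inE eqxx.
  rewrite -hook_rank_lt // rv; move: lxlt; rewrite -hook_rank_lt // rw => lt.
  rewrite ltn_neqAle -ltnS (leq_trans lt r'r) andbT -rv.
  by apply/eqP => /(hook_rank_inj li xh vv) e; rewrite e eqxx in xv.
Qed.

Lemma card_rank_class_le r r' : r <= r'.+1 -> r' <= r.+1 -> r' < #|hook v| ->
  #|rank_class r| <= #|rank_class r'|.
Proof.
move=> rr' r'r r'h; have H l := @rank_swap_class _ _ l rr' r'r r'h.
rewrite -(@card_in_imset _ _ (rank_swap r')).
  by apply: subset_leq_card; apply/fintype.subsetP => _ /imsetP[l /H[? _] ->].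
by move=> l1 l2 /H[_ e1] /H[_ e2] e; rewrite -e1 e e2.
Qed.

Lemma card_rank_class r : r < #|hook v| -> #|rank_class r| = #|rank_class 0|.
Proof.
elim: r => // r IH rh; rewrite -IH; last exact: ltnW.
by apply/eqP; rewrite eqn_leq !card_rank_class_le //; lia.
Qed.

Lemma rank_class0 : rank_class 0 = increasing_on D.
Proof.
have vv : v \in hook v by rewrite inE.
apply/setP => l; rewrite inE; apply/andP/increasing_onP.
  move=> [/increasing_onP[li ldec] /eqP r0]; split=> // u x uD ux lux.
  have [uv|uv] := eqVneq u v; last by apply: ldec => //; rewrite !inE uv.
  subst u; rewrite -hook_rank_lt // r0 lt0n -r0; apply/eqP => e.
  by move: ux; rewrite -(hook_rank_inj li _ vv e) ?eqxx // inE.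
move=> [li ldec]; split.
  apply/increasing_onP; split=> // u x; rewrite !inE => /andP[_].
  exact: ldec.
rewrite cards_eq0; apply/eqP/setP => x; rewrite !inE; apply/negP => /andP[vx].
have [->|xv] := eqVneq v x; first by rewrite ltnn.
by apply/negP; rewrite -leqNgt ltnW // ldec.
Qed.

Lemma card_increasing_on_step :
  #|increasing_on D| * #|hook v| = #|increasing_on (D :\ v)|.
Proof.
have h0 : v \in hook v by rewrite inE.
rewrite -[RHS]sum1_card.
(* The constant labelling only provides an element of ['I_#|hook v|] as default for [insubd]; the
   rank of [v] is always in range. *)
rewrite (partition_big
  (fun l => insubd (Ordinal (ltn_hook_rank [ffun=> enum_rank v] h0)) (hook_rank l v))
  predT) //=.
rewrite -rank_class0 mulnC -[in LHS](card_ord #|hook v|) -sum_nat_const.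
apply: eq_bigr => r _; rewrite -(card_rank_class (ltn_ord r)) -sum1_card.
apply: eq_bigl => l; rewrite inE -val_eqE val_insubd ltn_hook_rank //.
Qed.

End Step.

(** Induction on [#|D|], removing a minimal node of [D] so that the rest is still an upset. *)
Lemma hook_length_on (D : {set T}) (le_anti : antisymmetric le) : upset D ->
  #|increasing_on D| * \prod_(v in D) #|hook v| = (#|T|)`!.
Proof.
have [k] := ubnP #|D|; elim: k D => // k IH D Dk upD.
have [->|[x0 x0D]] := set_0Vmem D.
  have -> : (#|T|)`! = #|'I_#|T| | ^_ #|T| by rewrite card_ord ffactnn.
  rewrite big_set0 muln1 -card_inj_ffuns.
  apply: eq_card => l; rewrite !inE; case: injectiveb => //=.
  by apply/forall_inP => u; rewrite inE.
have [v vD vmin] : exists2 v, v \in D & forall u, u \in D -> le u v -> u = v.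
  (* A node of [D] with the fewest ancestors is minimal in [D]. *)
  pose m v := #|[set u | le u v]|.
  case: (arg_minnP m x0D) => v vD vm; exists v => // u uD uv.
  apply: le_anti; rewrite uv /=; have := vm u uD; apply: contraTT => nvu.
  rewrite -ltnNge; apply: proper_card; apply/properP; split.
    by apply/fintype.subsetP => z; rewrite !inE => /le_trans; apply.
  by exists v; rewrite !inE.
have upD' : upset (D :\ v).
  move=> u x; rewrite !inE => /andP[uv uD] ux; rewrite (upD u) // andbT.
  by apply/eqP => xv; subst x; rewrite (vmin u) ?eqxx in uv.
rewrite (big_setD1 v) //= mulnA card_increasing_on_step // IH //.
by move: Dk; rewrite (cardsD1 v D) vD.
Qed.

Lemma hook_length (le_anti : antisymmetric le) :
  #|increasing_on [set: T]| * \prod_(v : T) #|hook v| = (#|T|)`!.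
Proof.
rewrite -(@hook_length_on [set: T]) //.
by congr (_ * _); apply: eq_bigl => v; rewrite inE.
Qed.

End HookLength.

(** * Nodes and isomorphisms *)

Local Notation leaf := (PNode [::]).

Lemma ptree_nested_ind (P : ptree -> Prop) :
  (forall s, {in s, forall t, P t} -> P (PNode s)) -> forall t, P t.
Proof.
move=> IH; fix F 1 => -[s]; apply: IH.
elim: s => [x xs|t s IHs x]; first by case: (notF xs).
rewrite inE; case/predU1P => [->|]; [apply: F | apply: IHs].
Qed.

Lemma nodes_PNode s : nodes (PNode s) =
  [::] :: [seq i :: u | i <- iota 0 (size s), u <- nodes (nth leaf s i)].
Proof.
rewrite /=; congr (_ :: flatten _); apply/eq_in_map => i.
by rewrite mem_iota => /andP[_ /=]; rewrite add0n => /(nth_map leaf [::] nodes) ->.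
Qed.

Lemma nodes_nil t : [::] \in nodes t.
Proof. by case: t => s; rewrite inE. Qed.

Lemma nodes_cons s i u :
  (i :: u \in nodes (PNode s)) = (i < size s)%N && (u \in nodes (nth leaf s i)).
Proof.
rewrite nodes_PNode inE /=; apply/allpairsPdep/andP => [[j [w [+ wN [-> ->]]]]|[iN uN]].
  by rewrite mem_iota.
by exists i, u; rewrite mem_iota.
Qed.

Lemma nodes_catl t u w : u ++ w \in nodes t -> u \in nodes t.
Proof.
elim: u t => [|i u IH] t; first by rewrite nodes_nil.
by case: t => s; rewrite cat_cons !nodes_cons => /andP[-> /IH].
Qed.

Lemma uniq_nodes t : uniq (nodes t).
Proof.
elim/ptree_nested_ind: t => s IH; rewrite nodes_PNode /=; apply/andP; split.
  by apply/allpairsPdep => -[? [? []]].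
apply: allpairs_uniq_dep; first exact: iota_uniq.
  by move=> i; rewrite mem_iota => /andP[_ iN]; apply/IH/mem_nth.
by move=> [i u] [j w] _ _ [-> ->].
Qed.

Lemma big_node (R : Type) (idx : R) (op : Monoid.com_law idx) t (F : seq nat -> R) :
  \big[op/idx]_(v : node t) F (val v) = \big[op/idx]_(a <- nodes t) F a.
Proof.
rewrite -[LHS](big_map val xpredT F); apply/perm_big/uniq_perm.
- rewrite map_inj_uniq; [exact: index_enum_uniq | exact: val_inj].
- exact: uniq_nodes.
move=> a; apply/mapP/idP => [[v _ ->]|aN]; first exact: valP.
by exists (SeqSub aN); rewrite ?mem_index_enum.
Qed.

Lemma porderE t : porder t = size (nodes t).
Proof. exact/card_seq_sub/uniq_nodes. Qed.

Lemma big_nth_iota (R I : Type) (idx : R) (op : Monoid.law idx) (x0 : I) s (F : I -> R) :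
  \big[op/idx]_(x <- s) F x = \big[op/idx]_(i <- iota 0 (size s)) F (nth x0 s i).
Proof. by rewrite (big_nth x0) /index_iota subn0. Qed.

Lemma porder_PNode s : porder (PNode s) = (\sum_(t <- s) porder t).+1.
Proof.
rewrite porderE nodes_PNode /= size_allpairs_dep sumnE big_map; congr S.
by rewrite (big_nth_iota _ leaf); apply: eq_bigr => i _; rewrite porderE.
Qed.

Lemma count_prefix_cons s i u : (i < size s)%N ->
  count (prefix (i :: u)) (nodes (PNode s)) = count (prefix u) (nodes (nth leaf s i)).
Proof.
move=> iN; rewrite nodes_PNode /= add0n -sum1_count big_mkcond big_allpairs_dep /=.
rewrite (bigD1_seq i) ?iota_uniq ?mem_iota //= [X in (_ + X)%N]big1 => [|j].
  by rewrite addn0 eqxx -sum1_count [RHS]big_mkcond.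
by rewrite eq_sym => /negPf ->; rewrite big1.
Qed.

(** The addresses extending [a] form the subtree at [a], so unfolding the recursion gives the
    product of the orders of all subtrees, which are the hook lengths. *)
Lemma pfactorialE t : pfactorial t = (\prod_(a <- nodes t) count (prefix a) (nodes t))%N.
Proof.
elim/ptree_nested_ind: t => s IH; rewrite nodes_PNode big_cons -nodes_PNode.
rewrite [LHS]/= porderE; congr (_ * _)%N.
  by rewrite -[LHS]count_predT; apply: eq_count => a; case: a.
rewrite big_map big_allpairs_dep (big_nth_iota _ leaf); apply: eq_big_seq => i.
rewrite mem_iota => /andP[_ iN]; rewrite IH ?mem_nth //; apply: eq_bigr => u _.
by rewrite count_prefix_cons.
Qed.

Lemma on_root_path_refl t : reflexive (@on_root_path t).
Proof. by move=> u; apply: prefix_refl. Qed.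

Lemma on_root_path_trans t : transitive (@on_root_path t).
Proof. by move=> v u w; apply: prefix_trans. Qed.

Lemma on_root_path_anti t : antisymmetric (@on_root_path t).
Proof.
move=> u v /andP[uv vu]; apply: val_inj; move: uv; rewrite /on_root_path prefixE.
by move=> /eqP {1}<-; rewrite take_oversize // size_prefix.
Qed.

Lemma on_root_path_chain t (x y z : node t) :
  on_root_path x z -> on_root_path y z -> on_root_path x y || on_root_path y x.
Proof.
rewrite /on_root_path !prefixE => /eqP xz /eqP yz.
case/orP: (leq_total (size (val x)) (size (val y))) => le.
  by rewrite -[in take _ _ == val x]yz take_takel // xz eqxx.
by rewrite -[in take _ _ == val y]xz take_takel // yz eqxx orbT.
Qed.

Lemma card_labellings t : (#|labellings t| * pfactorial t = (porder t)`!)%N.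
Proof.
rewrite -[RHS](hook_length (@on_root_path_refl t) (@on_root_path_trans t)
  (@on_root_path_chain t) (@on_root_path_anti t)).
congr (_ * _)%N; last first.
  rewrite pfactorialE -big_node; apply: eq_bigr => v _.
  rewrite -sum1_count big_mkcond -big_node -big_mkcond sum1_card.
  by apply: eq_card => u; rewrite inE.
apply: eq_card => l; rewrite !inE; congr andb.
by apply: eq_forallb => u; rewrite inE.
Qed.

Lemma is_isoP t p (f : {ffun node t -> node p}) :
  reflect (bijective f /\ forall u v, is_parent (f u) (f v) = is_parent u v)
          (is_iso f).
Proof.
apply: (iffP and3P) => [[/injectiveP f_inj /forallP f_surj f_par]|[[g fK gK] f_par]].
  split; last by move=> u v; apply/eqP; move/forallP/(_ u)/forallP: f_par.
  apply: inj_card_bij => //; rewrite -(card_codom f_inj); apply: subset_leq_card.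
  by apply/fintype.subsetP => v _; have /existsP[u /eqP <-] := f_surj v; apply: codom_f.
split; first exact/injectiveP/(can_inj fK).
- by apply/forallP => v; apply/existsP; exists (g v); rewrite gK.
- by apply/forallP => u; apply/forallP => v; rewrite f_par.
Qed.

Lemma is_iso_id t : is_iso [ffun u : node t => u].
Proof.
apply/is_isoP; split; last by move=> u v; rewrite !ffunE.
by exists id => u; rewrite ffunE.
Qed.

Lemma is_iso_comp t p q (f : {ffun node t -> node p}) (g : {ffun node p -> node q}) :
  is_iso f -> is_iso g -> is_iso [ffun u => g (f u)].
Proof.
move=> /is_isoP[fb fp] /is_isoP[gb gp]; apply/is_isoP; split.
  by apply: (eq_bij (bij_comp gb fb)) => u; rewrite ffunE.
by move=> u v; rewrite !ffunE gp fp.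
Qed.

Lemma is_iso_inv t p (f : {ffun node t -> node p}) : is_iso f ->
  exists g : {ffun node p -> node t}, [/\ is_iso g, cancel f g & cancel g f].
Proof.
move=> /is_isoP[[g fK gK] fp]; exists (finfun g).
have fK' : cancel f (finfun g) by move=> u; rewrite ffunE.
have gK' : cancel (finfun g) f by move=> u; rewrite ffunE.
split=> //; apply/is_isoP; split; first by exists f.
by move=> u v; rewrite -fp !gK'.
Qed.

(** A path from an ancestor is a chain of parent edges, one per letter of the address suffix [w]. *)
Lemma is_iso_on_root_path t p (f : {ffun node t -> node p}) u v : is_iso f ->
  on_root_path (f u) (f v) = on_root_path u v.
Proof.
have fwd t' p' (h : {ffun node t' -> node p'}) x y : is_iso h ->
    on_root_path x y -> on_root_path (h x) (h y).
  move=> /is_isoP[_ hp] /prefixP[w]; elim/last_ind: w y => [|w j IH] y yE.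
    by rewrite cats0 in yE; rewrite (val_inj yE) on_root_path_refl.
  have xwN : val x ++ w \in nodes t'.
    by apply: (@nodes_catl _ _ [:: j]); rewrite cats1 rcons_cat -yE; apply: valP.
  apply: (@on_root_path_trans _ (h (SeqSub xwN))); first exact: IH.
  suff : is_parent (h (SeqSub xwN)) (h y) by case/andP.
  by rewrite hp /is_parent /= yE -rcons_cat prefix_rcons size_rcons eqxx.
move=> fi; apply/idP/idP; last exact: fwd.
have [g [gi fK _]] := is_iso_inv fi.
by move=> /(fwd _ _ _ _ _ gi); rewrite !fK.
Qed.

Definition niso (t p : ptree) : nat := #|[set f : {ffun node t -> node p} | is_iso f]|.

Lemma niso_gt0 t p : (0 < niso t p)%N = isomorphic t p.
Proof.
apply/card_gt0P/existsP => -[f]; first by rewrite inE; exists f.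
by exists f; rewrite inE.
Qed.

Lemma niso_isomorphic t p : isomorphic t p -> niso t p = niso t t.
Proof.
have le q r s (f : {ffun node q -> node r}) : is_iso f -> (niso s q <= niso s r)%N.
  move=> fi; have /is_isoP[/bij_inj f_inj _] := fi.
  rewrite /niso -(@card_in_imset _ _ (fun h : {ffun node s -> node q} => [ffun u => f (h u)])).
    apply: subset_leq_card; apply/fintype.subsetP => _ /imsetP[h + ->].
    by rewrite !inE => hi; apply: is_iso_comp.
  move=> h h' _ _ /ffunP e; apply/ffunP => u; apply: f_inj.
  by move: (e u); rewrite !ffunE.
move=> /existsP[f fi]; have [g [gi _ _]] := is_iso_inv fi.
by apply/eqP; rewrite eqn_leq (le _ _ _ _ gi) (le _ _ _ _ fi).
Qed.

(** The class of [l] is its orbit under automorphisms, and the action is free because [l] is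
    injective. *)
Lemma card_labelled_iso_class t l : l \in labellings t ->
  #|[set l' in labellings t | labelled_iso l l']| = niso t t.
Proof.
rewrite inE => /andP[/injectiveP l_inj /forallP l_inc].
rewrite /niso -(@card_in_imset _ _ (fun f : {ffun node t -> node t} => [ffun u => l (f u)])).
  apply: eq_card => l'; apply/idP/imsetP => [|[f + ->]]; rewrite !inE.
    move=> /andP[_ /existsP[f /andP[fi /forallP lf]]].
    have [g [gi _ gK]] := is_iso_inv fi; exists g; rewrite ?inE //.
    by apply/ffunP => u; rewrite ffunE -(eqP (lf (g u))) gK.
  move=> fi; have /is_isoP[/bij_inj f_inj _] := fi; rewrite -andbA; apply/and3P; split.
  - by apply/injectiveP => u v; rewrite !ffunE => /l_inj/f_inj.
  - apply/forallP => u; apply/forallP => v; rewrite !ffunE -(is_iso_on_root_path _ _ fi).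
    by rewrite -(inj_eq f_inj); have /forallP := l_inc (f u); apply.
  have [g [gi _ gK]] := is_iso_inv fi; apply/existsP; exists g; rewrite gi.
  by apply/forallP => u; rewrite ffunE gK.
move=> h h' _ _ /ffunP e; apply/ffunP => u; apply: l_inj.
by move: (e u); rewrite !ffunE.
Qed.

Lemma labelled_iso_equiv t : equivalence_rel (@labelled_iso t).
Proof.
apply/equivalence_relP; split.
  move=> l; apply/existsP; exists [ffun u => u]; rewrite is_iso_id.
  by apply/forallP => u; rewrite ffunE.
have sym l1 l2 : labelled_iso l1 l2 -> labelled_iso l2 l1.
  move=> /existsP[f /andP[/is_iso_inv[g [gi _ gK]] /forallP lf]].
  apply/existsP; exists g; rewrite gi; apply/forallP => u.
  by rewrite -(eqP (lf (g u))) gK.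
have tr : transitive (@labelled_iso t).
  move=> l2 l1 l3 /existsP[f /andP[fi /forallP lf]] /existsP[g /andP[gi /forallP lg]].
  apply/existsP; exists [ffun u => g (f u)]; rewrite is_iso_comp //.
  by apply/forallP => u; rewrite ffunE (eqP (lg _)) (eqP (lf _)).
by move=> l1 l2 l12 l3; apply/idP/idP; apply: tr => //; apply: sym.
Qed.

Lemma palpha_niso t : (palpha t * niso t t = #|labellings t|)%N.
Proof.
apply/esym/(card_uniform_partition (P := equivalence_partition (@labelled_iso t) _)).
  by move=> A /imsetP[l lL ->]; apply: card_labelled_iso_class.
by apply: equivalence_partitionP => l1 l2 l3 _ _ _; apply: labelled_iso_equiv.
Qed.

(** * Isomorphisms and branches *)

Definition root t : node t := SeqSub (nodes_nil t).

Lemma is_parent_root t (v : node t) : is_parent v (root t) = false.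
Proof. by rewrite /is_parent /= andbF. Qed.

Lemma parent_exists t (v : node t) : v <> root t -> exists u, is_parent u v.
Proof.
case: v => a aN; elim/last_ind: a aN => [|a b _] aN v_root.
  by case: v_root; apply: val_inj.
have aN' : a \in nodes t by apply: (@nodes_catl _ _ [:: b]); rewrite cats1.
by exists (SeqSub aN'); rewrite /is_parent /= prefix_rcons size_rcons eqxx.
Qed.

Section Branch.
Variables (k : nat) (s : seq ptree) (sk : size s = k).

Lemma branch_subproof (i : 'I_k) (u : node (nth leaf s i)) :
  (i : nat) :: val u \in nodes (PNode s).
Proof. by rewrite nodes_cons sk ltn_ord (valP u). Qed.

(** Indexing by ['I_k] with [size s = k], instead of ['I_(size s)], lets two lists of branches of
    the same length share one index type, on which permutations act. *)
Definition branch i u : node (PNode s) := SeqSub (@branch_subproof i u).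

Lemma branch_inj1 i j u w : @branch i u = @branch j w -> i = j.
Proof. by move=> /(congr1 val)/= [/val_inj]. Qed.

Lemma branch_inj2 i u w : @branch i u = @branch i w -> u = w.
Proof. by move=> /(congr1 val)/= [/val_inj]. Qed.

Lemma node_PNodeP v : v = root (PNode s) \/ exists i u, v = @branch i u.
Proof.
case: v => -[|i u] vN; first by left; apply: val_inj.
right; have := vN; rewrite nodes_cons => /andP[iN uN]; rewrite sk in iN.
by exists (Ordinal iN), (SeqSub uN); apply: val_inj.
Qed.

Lemma is_parent_root_branch i u :
  is_parent (root (PNode s)) (@branch i u) = (u == root _).
Proof.
rewrite /is_parent /= eqSS; apply/eqP/eqP => [/size0nil u0|-> //].
exact: val_inj.
Qed.

Lemma is_parent_branch i j u w : is_parent (@branch i u) (@branch j w) =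
  (i == j) && (prefix (val u) (val w) && (size (val w) == (size (val u)).+1)).
Proof. by rewrite /is_parent /= eqSS andbA. Qed.

Lemma is_parent_branch1 i u w : is_parent (@branch i u) (@branch i w) = is_parent u w.
Proof. by rewrite is_parent_branch eqxx. Qed.

End Branch.

Lemma is_iso_root t p (f : {ffun node t -> node p}) : is_iso f -> f (root t) = root p.
Proof.
move=> fi; have [g [_ _ gK]] := is_iso_inv fi; have /is_isoP[_ fp] := fi.
apply/eqP/negPn/negP => /eqP/parent_exists[u].
by rewrite -[u]gK fp is_parent_root.
Qed.

Section IsoBranches.
Variables (k k' : nat) (s s' : seq ptree) (sk : size s = k) (sk' : size s' = k').
Variable f : {ffun node (PNode s) -> node (PNode s')}.
Hypothesis f_iso : is_iso f.

(** The root is fixed, so its children go to children of the root, which defines [h]; the rest of a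
    branch follows by induction on addresses, since a parent edge not issued from the root stays in
    one branch. *)
Lemma is_iso_branches : exists h : 'I_k -> 'I_k',
  injective h /\ forall i u, exists w, f (branch sk (i := i) u) = branch sk' (i := h i) w.
Proof.
have /is_isoP[/bij_inj f_inj fp] := f_iso.
have /fin_all_exists[h hE] (i : 'I_k) : exists j : 'I_k', f (branch sk (root (nth leaf s i))) =
    branch sk' (root (nth leaf s' j)).
  have : is_parent (root _) (branch sk (root (nth leaf s i))).
    by rewrite is_parent_root_branch.
  rewrite -fp is_iso_root //.
  have [->|[j [w ->]]] := node_PNodeP sk' (f (branch sk (root (nth leaf s i)))).
    by rewrite is_parent_root.
  by rewrite is_parent_root_branch => /eqP ->; exists j.
exists h; split=> [i j e|i [a aN]].
  have: f (branch sk (root (nth leaf s i))) = f (branch sk (root (nth leaf s j))).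
    by rewrite !hE e.
  by move/f_inj/branch_inj1.
elim/last_ind: a aN => [|a b IH] aN.
  by exists (root _); rewrite -hE; congr (f (branch _ _)); apply: val_inj.
have aN' : a \in nodes (nth leaf s i) by apply: (@nodes_catl _ _ [:: b]); rewrite cats1.
have [w fw] := IH aN'.
have : is_parent (branch sk (SeqSub aN')) (branch sk (SeqSub aN)).
  by rewrite is_parent_branch1 /is_parent /= prefix_rcons size_rcons eqxx.
rewrite -fp fw; have [->|[j [x ->]]] := node_PNodeP sk' (f (branch sk (SeqSub aN))).
  by rewrite is_parent_root.
by rewrite is_parent_branch => /andP[/eqP e _]; case: _ / e x => x; exists x.
Qed.

End IsoBranches.

Lemma isomorphic_size s s' : isomorphic (PNode s) (PNode s') -> size s = size s'.
Proof.
have le r r' : isomorphic (PNode r) (PNode r') -> (size r <= size r')%N.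
  move=> /existsP[f /(is_iso_branches (erefl _) (erefl _))[h [h_inj _]]].
  by rewrite -(card_ord (size r)) -(card_ord (size r')) -(card_codom h_inj) max_card.
by move=> e; apply/eqP; rewrite eqn_leq !le // isomorphic_sym.
Qed.

Section Glue.
Variables (k : nat) (s s' : seq ptree) (sk : size s = k) (sk' : size s' = k).

Definition ptree_iso t p := {f : {ffun node t -> node p} | is_iso f}.

Lemma card_ptree_iso t p : #|{: ptree_iso t p}| = niso t p.
Proof. by rewrite card_sig; apply: eq_card => f; rewrite !inE. Qed.

Definition unsplit_node (d : option {i : 'I_k & node (nth leaf s i)}) : node (PNode s) :=
  if d is Some x then branch sk (tagged x) else root _.

Lemma unsplit_node_inj : injective unsplit_node.
Proof.
move=> [[i u]|] [[j w]|] //= e.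
have ij := branch_inj1 e; case: _ / ij w e => w e.
by rewrite (branch_inj2 e).
Qed.

Definition branch_isos (h : 'S_k) : finType :=
  {dffun forall i : 'I_k, ptree_iso (nth leaf s i) (nth leaf s' (h i))}.

(** The isomorphism assembled from a permutation of the branches and an isomorphism on each of them;
    [pick] inverts [unsplit_node], whose value at [None] is the root. *)
Definition glue (y : {h : 'S_k & branch_isos h}) : {ffun node (PNode s) -> node (PNode s')} :=
  [ffun v => if [pick d | unsplit_node d == v] is Some (Some x) then
      branch sk' (i := tag y (tag x)) (val (tagged y (tag x)) (tagged x))
    else root _].

Lemma glue_root y : glue y (root _) = root _.
Proof.
by rewrite ffunE; case: pickP => [[x|]|].
Qed.

Lemma glue_branch y i u :
  glue y (branch sk (i := i) u) = branch sk' (val (tagged y i) u).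
Proof.
pose x := Some (@Tagged _ i (fun j : 'I_k => node (nth leaf s j)) u).
rewrite ffunE; case: pickP => [d /eqP e|/(_ x)]; last by rewrite eqxx.
by rewrite (@unsplit_node_inj d x e).
Qed.

Lemma glue_inj : injective glue.
Proof.
move=> [h g] [h' g'] /ffunP e.
have hh' : h = h'.
  by apply/permP => i; have := e (branch sk (root (nth leaf s i)));
    rewrite !glue_branch => /branch_inj1.
case: _ / hh' g' e => g' e; congr (Tagged _ _); apply/ffunP => i; apply/val_inj/ffunP => u.
by have := e (branch sk u); rewrite !glue_branch => /branch_inj2.
Qed.

Lemma glue_iso y : is_iso (glue y).
Proof.
have H i := valP (tagged y i).
apply/is_isoP; split.
  have glue_i : injective (glue y).
    move=> u v; have [->|[i [{}u ->]]] := node_PNodeP sk u;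
      have [->|[j [{}v ->]]] := node_PNodeP sk v => //; rewrite ?glue_root ?glue_branch //.
    move=> e; have /perm_inj ij := branch_inj1 e; case: _ / ij v e => v /branch_inj2.
    by have /is_isoP[/bij_inj gi _] := H i; move=> /gi ->.
  have glue_s v : exists u, glue y u = v.
    have [->|[j [w ->]]] := node_PNodeP sk' v; first by exists (root _); rewrite glue_root.
    move: w; rewrite -[j](permKV (tag y)) => w.
    have [g [_ _ gK]] := is_iso_inv (H ((tag y)^-1 j)%g).
    by exists (branch sk (g w)); rewrite glue_branch gK.
  have /fin_all_exists[g gK] := glue_s.
  by exists g => // u; apply: glue_i; rewrite gK.
move=> u v; have [->|[i [{}u ->]]] := node_PNodeP sk u;
  have [->|[j [{}v ->]]] := node_PNodeP sk v; rewrite ?glue_root ?glue_branch ?is_parent_root //.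
  rewrite !is_parent_root_branch; have /is_isoP[/bij_inj gi _] := H j.
  by rewrite -(inj_eq gi) (is_iso_root (H j)).
have [ij|ij] := eqVneq i j; last first.
  by rewrite !is_parent_branch (inj_eq perm_inj) (negPf ij).
case: _ / ij v => v; rewrite !is_parent_branch1.
by have /is_isoP[_ ->] := H i.
Qed.

Lemma glue_surj f : is_iso f -> exists y, f = glue y.
Proof.
move=> fi; have [h0 [h0_inj hE]] := is_iso_branches sk sk' fi.
have /is_isoP[/bij_inj f_inj fp] := fi.
have [f' [_ _ f'K]] := is_iso_inv fi.
pose h := perm h0_inj.
have hE' i u : exists w, f (branch sk (i := i) u) = branch sk' (i := h i) w.
  by rewrite permE.
have /fin_all_exists[g gE] i := fin_all_exists (hE' i).
have gi i : is_iso (finfun (g i)).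
  have g_inj : injective (g i).
    move=> u v e; have: f (branch sk u) = f (branch sk v) by rewrite !gE e.
    by move/f_inj/branch_inj2.
  apply/is_isoP; split; last first.
    by move=> u v; rewrite !ffunE -(is_parent_branch1 sk') -!gE fp is_parent_branch1.
  (* The preimage of [w] under [f] lies in some branch [j] with [h j = h i], hence in branch [i]. *)
  have g_surj w : exists u, g i u = w.
    have := f'K (branch sk' w).
    have [->|[j [u ->]]] := node_PNodeP sk (f' (branch sk' w)).
      by rewrite is_iso_root // => /(congr1 val).
    rewrite gE => e; have /perm_inj ji := branch_inj1 e.
    by case: _ / ji w e => w /branch_inj2; exists u.
  have /fin_all_exists[g' g'K] := g_surj.
  exists g' => u; last by rewrite ffunE.
  by apply: g_inj; rewrite g'K ffunE.
exists (Tagged branch_isos [ffun i => exist (fun f => is_iso f) _ (gi i) : ptree_iso _ _]).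
apply/ffunP => v; have [->|[i [u ->]]] := node_PNodeP sk v.
  by rewrite glue_root is_iso_root.
by rewrite glue_branch gE /= ffunE /= ffunE.
Qed.

Lemma niso_PNode : niso (PNode s) (PNode s') =
  (\sum_(h : 'S_k) \prod_(i < k) niso (nth leaf s i) (nth leaf s' (h i)))%N.
Proof.
have -> : niso (PNode s) (PNode s') = #|{: {h : 'S_k & branch_isos h}}|.
  rewrite -cardsT -(card_imset _ glue_inj); apply: eq_card => f; rewrite inE.
  apply/idP/imsetP => [/glue_surj[y ->]|[y _ ->]]; first by exists y.
  exact: glue_iso.
rewrite card_tagged sumnE big_map big_enum; apply: eq_bigr => h _.
rewrite card_dep_ffun foldrE big_image; apply: eq_bigr => i _.
exact: card_ptree_iso.
Qed.

End Glue.

(** * Planar trees of a given order *)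

Lemma isomorphic_PNode s s' : isomorphic (PNode s) (PNode s') ->
  size s' = size s /\ exists h : 'S_(size s),
    forall i : 'I_(size s), isomorphic (nth leaf s i) (nth leaf s' (h i)).
Proof.
move=> iso; have ss' := isomorphic_size iso; split=> //.
move: iso; rewrite -niso_gt0 (niso_PNode (erefl _) (esym ss')) lt0n sum_nat_eq0.
move=> /forallPn[h]; rewrite implyTb => hn; exists h => i; rewrite -niso_gt0 lt0n.
by apply: contraNneq hn => e; rewrite (bigD1 i) //= e.
Qed.

Lemma isomorphic_porder t p : isomorphic t p -> porder t = porder p.
Proof. by move=> /isomorphicP[f /bij_eq_card]. Qed.

(** Isomorphic trees have pairwise isomorphic branches up to a permutation, which a commutative
    operation does not see. *)
Lemma isomorphic_invariant (R : Type) (idx : R) (op : Monoid.com_law idx)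
    (g : ptree -> R) (F : nat -> nat -> R -> R) :
  (forall s, g (PNode s) = F (size s) (porder (PNode s)) (\big[op/idx]_(t <- s) g t)) ->
  forall t p, isomorphic t p -> g t = g p.
Proof.
move=> gE; elim/ptree_nested_ind => s IH [s'] iso.
have [ss' [h hi]] := isomorphic_PNode iso.
rewrite !gE (isomorphic_porder iso) ss'; congr F.
rewrite !(big_nth leaf) ss' !big_mkord [RHS](reindex_inj (@perm_inj _ h)).
by apply: eq_bigr => i _; apply: IH; rewrite ?mem_nth.
Qed.

(* The sequences of k trees of total order n, T i listing the trees of order  *)
(* i.                                                                         *)
Fixpoint forests (T : nat -> seq ptree) (k n : nat) : seq (seq ptree) :=
  if k is k'.+1 then
    [seq x | i <- iota 0 n.+1, x <- [seq t :: s | t <- T i, s <- forests T k' (n - i)%N]]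
  else nseq (n == 0%N) [::].

Lemma forestsS T k n : forests T k.+1 n =
  [seq x | i <- iota 0 n.+1, x <- [seq t :: s | t <- T i, s <- forests T k (n - i)%N]].
Proof. by []. Qed.

(** The trees of order n call on those of all smaller orders through [forests], which is not a
    structural recursion; by [ptrees_fuelE] any fuel at least n gives the same list. *)
Fixpoint ptrees_fuel (f n : nat) : seq ptree :=
  if f is f'.+1 then
    if n is m.+1 then
      [seq PNode s | k <- iota 0 m.+1, s <- forests (ptrees_fuel f') k m]
    else [::]
  else [::].

Definition ptrees n := ptrees_fuel n n.

Lemma eq_forests T T' k n : (forall i, (i <= n)%N -> T i = T' i) ->
  forests T k n = forests T' k n.
Proof.
elim: k n => // k IH n TT'; rewrite !forestsS; congr flatten; apply/eq_in_map => i.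
rewrite mem_iota add0n ltnS => /andP[_ ile]; rewrite TT' //; congr map.
congr flatten; apply: eq_map => t; rewrite (IH (n - i)%N) // => j jle.
by apply: TT'; rewrite (leq_trans jle) // leq_subr.
Qed.

Lemma ptrees_fuelE f f' n : (n <= f)%N -> (n <= f')%N -> ptrees_fuel f n = ptrees_fuel f' n.
Proof.
elim: f f' n => [|f IH] [|f'] [|n] // nf nf'.
congr flatten; apply: eq_map => k; congr map; apply: eq_forests => i ile.
by apply: IH; apply: leq_trans ile _.
Qed.

Lemma ptreesS n : ptrees n.+1 =
  [seq PNode s | k <- iota 0 n.+1, s <- forests ptrees k n].
Proof.
congr flatten; apply: eq_map => k; congr map; apply: eq_forests => i ile.
exact: ptrees_fuelE.
Qed.

Lemma big_forestsS (R : Type) (idx : R) (op : Monoid.com_law idx) T k n F :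
  \big[op/idx]_(s <- forests T k.+1 n) F s =
  \big[op/idx]_(i < n.+1) \big[op/idx]_(t <- T i)
     \big[op/idx]_(s <- forests T k (n - i)%N) F (t :: s).
Proof.
rewrite forestsS big_allpairs_dep -[X in iota _ X]subn0 -/(index_iota _ _).
by rewrite big_mkord; apply: eq_bigr => i _; rewrite big_allpairs_dep.
Qed.

Lemma size_forests T k n s : s \in forests T k n -> size s = k.
Proof.
elim: k n s => [|k IH] n s; first by rewrite mem_nseq => /andP[_ /eqP ->].
by move=> /allpairsPdep[i [_ [_ /allpairsPdep[t [r [_ /IH <- ->]]] ->]]].
Qed.

Lemma porder_forests T k n s :
  (forall i t, (i <= n)%N -> t \in T i -> porder t = i) ->
  s \in forests T k n -> (\sum_(t <- s) porder t)%N = n.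
Proof.
elim: k n s => [|k IH] n s TP.
  by rewrite mem_nseq lt0b => /andP[/eqP -> /eqP ->]; rewrite big_nil.
move=> /allpairsPdep[i [_ [+ /allpairsPdep[t [r [tT rF ->]]] ->]]].
rewrite mem_iota add0n ltnS => /andP[_ ile]; rewrite big_cons (TP i) //.
rewrite (IH (n - i)%N) ?subnKC // => j u jle.
by apply: TP; rewrite (leq_trans jle) // leq_subr.
Qed.

Lemma porder_ptrees n t : t \in ptrees n -> porder t = n.
Proof.
have [m] := ubnP n; elim: m n t => // m IH [|n] t //.
rewrite ltnS ptreesS => nm /allpairsPdep[k [s [_ sF ->]]]; rewrite porder_PNode.
congr S; apply: porder_forests sF => i u ile; apply: IH.
exact: leq_ltn_trans nm.
Qed.

(** Only forests whose i-th tree has order [m i] contribute, and their i-th trees are chosen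
    independently. *)
Lemma sum_forests_prod k n (m : 'I_k -> nat) (F : 'I_k -> ptree -> nat) :
  (forall i p, porder p != m i -> F i p = 0%N) -> (\sum_(i < k) m i)%N = n ->
  (\sum_(s <- forests ptrees k n) \prod_(i < k) F i (nth leaf s i) =
   \prod_(i < k) \sum_(p <- ptrees (m i)) F i p)%N.
Proof.
elim: k n m F => [|k IH] n m F F0 mn.
  by rewrite !big_ord0 in mn *; rewrite -mn /= big_seq1 big_ord0.
rewrite big_ord_recl in mn; rewrite big_forestsS [RHS]big_ord_recl /=.
have m0 : (m ord0 < n.+1)%N by rewrite ltnS -mn leq_addr.
rewrite (bigD1 (Ordinal m0)) //= [X in (_ + X)%N]big1 ?addn0 => [|i im].
  rewrite big_distrl; apply: eq_bigr => t _ /=.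
  rewrite -(IH (n - m ord0)%N (m \o lift ord0) (fun i => F (lift ord0 i))) //; last first.
  - by rewrite -mn addKn.
  - by move=> i p; apply: F0.
  by rewrite big_distrr; apply: eq_bigr => s _; rewrite big_ord_recl.
rewrite big_seq big1 // => t /porder_ptrees ti; rewrite big1 // => s _.
by rewrite big_ord_recl F0 //= ti; apply: contraNneq im => e; apply/eqP/val_inj.
Qed.

Fixpoint arity_factorial (t : ptree) : nat :=
  let: PNode s := t in ((size s)`! * \prod_(x <- map arity_factorial s) x)%N.

(* The left-hand side counts the planar trees equipped with an isomorphism    *)
(* from t, i.e. the ways of ordering the children of each node of t.          *)
Lemma sum_niso t : (\sum_(p <- ptrees (porder t)) niso t p = arity_factorial t)%N.
Proof.
elim/ptree_nested_ind: t => s IH; rewrite porder_PNode ptreesS big_allpairs_dep.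
set n := (\sum_(t <- s) porder t)%N.
have sn : (size s <= n)%N.
  by rewrite -sum1_size; apply: leq_sum => -[r] _; rewrite porder_PNode.
rewrite (bigD1_seq (size s)) ?iota_uniq ?mem_iota //= [X in (_ + X)%N]big1 ?addn0 => [|k ks].
  under eq_big_seq => s' /size_forests s's do rewrite (niso_PNode (erefl _) s's).
  (* Each of the k! permutations [h] contributes the same product, which accounts for the factor
     [(size s)!] of [arity_factorial]. Reindexing by the inverse of [h] attaches the factors to the
     positions of [s'], as [sum_forests_prod] requires. *)
  rewrite exchange_big /= big_map -(card_Sn (size s)) -sum_nat_const.
  apply: eq_bigr => h _.
  under eq_bigr => s' _.
    rewrite (reindex_inj (@perm_inj _ h^-1%g)).
    under eq_bigr => j _ do rewrite permKV.
    over.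
  rewrite (sum_forests_prod (m := fun i => porder (nth leaf s (h^-1%g i)))
    (F := fun i => niso (nth leaf s (h^-1%g i)))); last first.
  - rewrite /n (big_nth leaf) big_mkord [RHS](reindex_inj (@perm_inj _ h^-1%g)).
    by [].
  - move=> i p; apply: contraNeq; rewrite -lt0n niso_gt0 => /isomorphic_porder ->.
    by [].
  rewrite (big_nth leaf) big_mkord [RHS](reindex_inj (@perm_inj _ h^-1%g)).
  by apply: eq_bigr => i _; rewrite IH ?mem_nth.
rewrite big_seq big1 // => s' /size_forests s'k; apply/eqP; rewrite -leqn0 leqNgt niso_gt0.
by apply/negP => /isomorphic_size e; rewrite -s'k e eqxx in ks.
Qed.

Lemma count_isomorphic t :
  (count (isomorphic t) (ptrees (porder t)) * niso t t = arity_factorial t)%N.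
Proof.
rewrite -sum_niso -sum1_count big_distrl /= big_mkcond; apply: eq_bigr => p _.
case: ifPn => [/niso_isomorphic ->|]; first by rewrite mul1n.
by rewrite -niso_gt0 lt0n negbK => /eqP.
Qed.

Lemma pi_rtree (t : rtree) p : (\pi_rtree%qT p == t) = isomorphic (repr t) p.
Proof.
by rewrite -[t in LHS]reprK eqmodE /= isomorphic_sym.
Qed.

(** * Weights and the differential equation *)

Lemma palpha_formula t : (palpha t * niso t t * pfactorial t = (porder t)`!)%N.
Proof. by rewrite palpha_niso card_labellings. Qed.

Lemma porder_gt0 t : (0 < porder t)%N.
Proof. by case: t => s; rewrite porder_PNode. Qed.

Lemma pfactorial_gt0 t : (0 < pfactorial t)%N.
Proof.
have := fact_gt0 (porder t); rewrite -palpha_formula.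
by rewrite !muln_gt0 => /andP[].
Qed.

Lemma arity_factorial_gt0 t : (0 < arity_factorial t)%N.
Proof.
elim/ptree_nested_ind: t => s IH; rewrite /= muln_gt0 fact_gt0 big_map.
by rewrite big_seq prodn_cond_gt0.
Qed.

Lemma isomorphic_pfactorial t p : isomorphic t p -> pfactorial t = pfactorial p.
Proof.
by apply: (@isomorphic_invariant _ _ muln _ (fun _ n x => (n * x)%N)) => s; rewrite /= big_map.
Qed.

Lemma isomorphic_arity_factorial t p : isomorphic t p -> arity_factorial t = arity_factorial p.
Proof.
by apply: (@isomorphic_invariant _ _ muln _ (fun k _ x => (k`! * x)%N)) => s; rewrite /= big_map.
Qed.

Section Weights.
Variables (R : realType) (psi : fps R) (psi0 : psi 0%N = 1) (l : nat).

(** As [psi 0 = 1], the special value at the one-node tree agrees with the general clause. *)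
Lemma pdelta_PNode s :
  pdelta psi (PNode s) = deriv_at0 psi (size s) * \prod_(t <- s) pdelta psi t.
Proof.
case: s => [|t s]; first by rewrite big_nil /deriv_at0 psi0 !mulr1.
by rewrite -(big_map (pdelta psi) xpredT id).
Qed.

Lemma isomorphic_pdelta t p : isomorphic t p -> pdelta psi t = pdelta psi p.
Proof.
by apply: (@isomorphic_invariant _ _ *%R _ (fun k _ x => deriv_at0 psi k * x));
  apply: pdelta_PNode.
Qed.

Definition weight (t : ptree) : R :=
  pdelta psi t / (arity_factorial t)%:R / (pfactorial t)%:R ^+ l.+1.

(** The factor k! in the k-th derivative of psi cancels the one in [arity_factorial]. *)
Lemma weight_PNode s : weight (PNode s) =
  psi (size s) * (\prod_(t <- s) weight t) / (porder (PNode s))%:R ^+ l.+1.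
Proof.
have -> : \prod_(t <- s) weight t = (\prod_(t <- s) pdelta psi t) /
    (\prod_(t <- s) arity_factorial t)%N%:R / (\prod_(t <- s) pfactorial t)%N%:R ^+ l.+1.
  by rewrite !natr_prod -prodrXl -!prodf_div.
rewrite /weight pdelta_PNode /deriv_at0 [arity_factorial _]/= [pfactorial _]/=.
rewrite !big_map !natrM exprMn.
have nz n : (0 < n)%N -> (n%:R : R) != 0 by rewrite pnatr_eq0 -lt0n.
field.
rewrite !expf_neq0 !nz ?fact_gt0 ?porder_gt0 // big_seq prodn_cond_gt0 // => t _.
  exact: arity_factorial_gt0.
exact: pfactorial_gt0.
Qed.

Lemma isomorphic_weight t p : isomorphic t p -> weight t = weight p.
Proof.
move=> tp; rewrite /weight (isomorphic_pdelta tp) (isomorphic_arity_factorial tp).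
by rewrite (isomorphic_pfactorial tp).
Qed.

(** By [palpha_formula], alpha(t) t! / n! is the inverse of [niso t t], which [count_isomorphic]
    rewrites as the number of planar forms of t over [arity_factorial t]. *)
Lemma Bseries_term t :
  ((porder t)`!%:R)^-1 * (palpha t)%:R * (1 / (pfactorial t)%:R ^+ l.+1) *
    (pfactorial t)%:R * pdelta psi t =
  weight t *+ count (isomorphic t) (ptrees (porder t)).
Proof.
have nz n : (0 < n)%N -> (n%:R : R) != 0 by rewrite pnatr_eq0 -lt0n.
have f0 := nz _ (fact_gt0 (porder t)); have p0 := nz _ (pfactorial_gt0 t).
have k0 := nz _ (arity_factorial_gt0 t).
rewrite -palpha_formula !natrM !mulf_eq0 !negb_or in f0; case/andP: f0 => /andP[a0 n0] _.
rewrite /weight -mulr_natr -palpha_formula -count_isomorphic !natrM.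
rewrite -count_isomorphic natrM mulf_eq0 negb_or in k0; case/andP: k0 => c0 _.
have := expf_neq0 l.+1 p0; move: (_ ^+ l.+1) => q q0.
by field; rewrite a0 n0 p0 c0 q0.
Qed.

Lemma Bseries_ptrees n :
  Bseries psi (fun t : rtree => 1 / (tree_factorial t)%:R ^+ l.+1) n =
  \sum_(p <- ptrees n) weight p.
Proof.
pose U := undup [seq \pi_rtree%qT p | p <- ptrees n].
have order_pi p : tree_order (\pi_rtree%qT p) = porder p.
  by apply: isomorphic_porder; rewrite -pi_rtree.
rewrite /Bseries; have -> : [set t : rtree | tree_order t = n]%classic = [set` U]%classic.
  apply/seteqP; split=> t /=; rewrite mem_undup; last first.
    by move=> /mapP[p /porder_ptrees <- ->].
  (* Completeness of the enumeration comes from [count_isomorphic]: a positive right-hand side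
     forces some listed tree to be isomorphic to [repr t]. *)
  move=> tn; have : (0 < count (isomorphic (repr t)) (ptrees n))%N.
    have := arity_factorial_gt0 (repr t).
    by rewrite -count_isomorphic -/(tree_order t) tn muln_gt0 => /andP[].
  rewrite -has_count => /hasP[p pn]; rewrite -pi_rtree => /eqP <-.
  exact: map_f.
rewrite -fsbig_seq ?undup_uniq // /U.
(* Each planar tree is charged to its own class, which occurs exactly once in [U], before the two
   sums are exchanged. *)
rewrite [RHS](eq_big_seq (fun p => \sum_(t <- U | \pi_rtree%qT p == t) weight p)); last first.
  move=> p pn; rewrite (big_rem (\pi_rtree%qT p)) /=; last by rewrite mem_undup map_f.
  rewrite eqxx big_seq_cond big1 ?addr0 // => t.
  by rewrite (rem_filter _ (undup_uniq _)) mem_filter /= eq_sym => /andP[/andP[/negPf ->]].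
rewrite (exchange_big_dep xpredT) //=; apply: eq_big_seq => t.
rewrite mem_undup => /mapP[q /porder_ptrees qn tq].
rewrite Bseries_term -/(tree_order t) tq order_pi qn -tq.
rewrite -sum1_count -sumrMnr; apply: eq_big => p; first by rewrite pi_rtree.
by rewrite mulr1n => /isomorphic_weight ->.
Qed.

(** Splitting off the first tree of a forest is the Cauchy product. *)
Lemma sum_forests_weight k n :
  \sum_(s <- forests ptrees k n) \prod_(t <- s) weight t =
  fps_exp (fun i => \sum_(p <- ptrees i) weight p) k n.
Proof.
elim: k n => [|k IH] n; first by case: n => [|n] /=; rewrite ?big_seq1 ?big_nil.
rewrite big_forestsS /= /fps_mul; apply: eq_bigr => i _.
rewrite -IH big_distrl; apply: eq_bigr => t _; rewrite big_distrr /=.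
by apply: eq_bigr => s _; rewrite big_cons.
Qed.

End Weights.

Lemma fps_euler1E (R : pzRingType) (a : fps R) n : fps_euler1 a n = n.+1%:R * a n.
Proof.
rewrite /fps_euler1 /fps_add /fps_euler /fps_mul -[n.+1]addn1 natrD mulrDl mul1r addn1.
congr (_ + _); case: n => [|n].
  by rewrite big_ord1 /fps_z mul0r mul0r.
rewrite !big_ord_recl /= /fps_z /fps_deriv mul0r add0r mul1r subn1 big1 ?addr0 // => i _.
by rewrite mul0r.
Qed.

Lemma iter_fps_euler1E (R : pzRingType) l (a : fps R) n :
  iter l (@fps_euler1 R) a n = n.+1%:R ^+ l * a n.
Proof.
elim: l => [|l IH]; first by rewrite mul1r.
by rewrite iterS fps_euler1E IH exprS mulrA.
Qed.

Theorem theorem2 (R : realType) (psi : fps R) (hpsi : psi 0%N = 1) (l : nat) :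
  let Y : fps R :=
    Bseries psi (fun t : rtree => 1 / (tree_factorial t)%:R ^+ l.+1) in
  iter l (@fps_euler1 R) (fps_deriv Y) = fps_comp psi Y.
Proof.
move=> Y; apply/funext => n.
have -> : Y = (fun n => \sum_(p <- ptrees n) weight psi l p).
  by apply/funext => m; apply: Bseries_ptrees.
(* The derivative supplies one more factor n+1. A tree of order n+1 has at most n branches at the
   root, the same truncation as in [fps_comp], so the sums are compared arity by arity. *)
rewrite iter_fps_euler1E /fps_deriv mulrA -exprSr ptreesS big_allpairs_dep.
rewrite -[X in iota _ X]subn0 -/(index_iota _ _) big_mkord big_distrr.
apply: eq_bigr => k _ /=; rewrite -sum_forests_weight !big_distrr /=.
apply: eq_big_seq => s sF; rewrite weight_PNode // (size_forests sF) porder_PNode.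
rewrite (porder_forests _ sF) => [|i t _ /porder_ptrees //].
by rewrite mulrC divfK // expf_neq0 // pnatr_eq0.
Qed.
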